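(* Let $\mathcal{V}$ be a semidegenerate congruence-modular variety and let $A\in\mathcal{V}$ be semiprime. If $I$ is an ideal of the lattice $L(A)$ then $(Ann(I))_{\ast}=(I_{\ast})^{\perp}$.
   Context: Algebras have a fixed finite signature $\tau$. A variety is semidegenerate if none of its nontrivial algebras has a one-element subalgebra. For $A$ in a semidegenerate congruence-modular variety $\mathcal{V}$, $Con(A)$ is the congruence lattice with least element $\Delta_A$ and greatest element $\nabla_A$; $K(A)$ is the set of compact (= finitely generated) congruences (here $\nabla_A\in K(A)$). $[\cdot,\cdot]$ is the modular commutator of Freese–McKenzie: the greatest operation on congruence lattices of members of $\mathcal{V}$ such that for every surjective morphism $f:A\to B$ and $\alpha,\beta\in Con(A)$, $[\alpha,\beta]_A\subseteq\alpha\cap\beta$ and $[\alpha,\beta]_A\lor Ker(f)=f^{-1}([f(\alpha\lor Ker(f)),f(\beta\lor Ker(f))]_B)$. It is commutative, monotone, distributes over arbitrary joins, and satisfies $[\theta,\nabla_A]=\theta$. The annihilator of $\alpha\in Con(A)$ is $\alpha^{\perp}=\bigvee\{\gamma\in Con(A)\mid[\alpha,\gamma]=\Delta_A\}$. A congruence $\phi\neq\nabla_A$ is prime if $[\alpha,\beta]\subseteq\phi$ implies $\alpha\subseteq\phi$ or $\beta\subseteq\phi$, for all $\alpha,\beta\in Con(A)$. $Spec(A)$ is the set of prime congruences. The radical is $\rho(\theta)=\bigwedge\{\phi\in Spec(A)\mid\theta\subseteq\phi\}$. $A$ is semiprime if $\rho(\Delta_A)=\Delta_A$. $C(A)$ is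 the smallest subset of $Con(A)$ containing $K(A)$ and closed under binary joins and commutators. For $\alpha,\beta\in C(A)$ put $\alpha\equiv\beta$ iff $\rho(\alpha)=\rho(\beta)$. $L(A)=C(A)/{\equiv}$ is a bounded distributive lattice with join induced by $\lor$, meet induced by $[\cdot,\cdot]$, $0$ = class of $\Delta_A$, $1$ = class of $\nabla_A$; $\lambda_A:C(A)\to L(A)$ is the quotient map. For an ideal $I$ of $L(A)$, $I_{\ast}=\bigvee\{\alpha\in K(A)\mid\lambda_A(\alpha)\in I\}\in Con(A)$. For an ideal $I$ of a bounded distributive lattice $L$, $Ann(I)=\{x\in L\mid x\land y=0\text{ for all }y\in I\}$, which is an ideal of $L$. *)

(* Defs.v *)
From HB Require Import structures.
From mathcomp Require Import all_boot all_order.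
From mathcomp Require Import boolp classical_sets functions cardinality.

Set Implicit Arguments.
Unset Strict Implicit.
Unset Printing Implicit Defensive.

Import Order.TTheory.
Local Open Scope classical_set_scope.
Local Open Scope quotient_scope.

Record signature := Signature { symbol :> finType; arity : symbol -> nat }.

Record algebra (tau : signature) := Algebra {
  carrier :> Type;
  carrier_inh : inhabited carrier;
  interp : forall f : tau, ('I_(arity f) -> carrier) -> carrier }.
Arguments interp {tau} a f args.

HB.instance Definition _ tau (A : algebra tau) := gen_eqMixin (carrier A).
HB.instance Definition _ tau (A : algebra tau) := gen_choiceMixin (carrier A).

Section Algebras.
Variable tau : signature.
Implicit Types A B : algebra tau.

Record hom A B := Hom {
  hom_fun :> A -> B;
  homP : forall f (args : 'I_(arity f) -> A),
    hom_fun (interp A f args) = interp B f (fun i => hom_fun (args i)) }.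

Definition surjective A B (h : A -> B) := forall y, exists x, h x = y.

Definition nontrivial A := exists x y : A, x <> y.

Definition subuniverse A (S : set A) := forall f (args : 'I_(arity f) -> A),
  (forall i, S (args i)) -> S (interp A f args).

Definition subalgebra A (S : set A) (hS : subuniverse S) (inhS : S !=set0) :
    algebra tau :=
  @Algebra tau {x : A | S x}
    (let: ex_intro x Sx := inhS in inhabits (exist S x Sx))
    (fun f args => exist S (interp A f (fun i => sval (args i)))
                           (hS f _ (fun i => svalP (args i)))).

Lemma product_inh (I : Type) (B : I -> algebra tau) :
  inhabited (forall i, B i).
Proof.
have inhB i : exists x : B i, True by case: (carrier_inh (B i)) => x; exists x.
by constructor => i; exact: (projT1 (cid (inhB i))).
Qed.

Definition product (I : Type) (B : I -> algebra tau) : algebra tau :=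
  @Algebra tau (forall i, B i) (product_inh B)
    (fun f args i => interp (B i) f (fun k => args k i)).

End Algebras.

Record variety (tau : signature) := Variety {
  in_variety :> algebra tau -> Prop;
  variety_hom : forall (A B : algebra tau) (h : hom A B),
    surjective h -> in_variety A -> in_variety B;
  variety_sub : forall (A : algebra tau) (S : set A)
    (hS : subuniverse S) (inhS : S !=set0),
    in_variety A -> in_variety (subalgebra hS inhS);
  variety_prod : forall (I : Type) (B : I -> algebra tau),
    (forall i, in_variety (B i)) -> in_variety (product B) }.

Record algebra_in tau (V : variety tau) := AlgebraIn {
  algebra_of :> algebra tau;
  algebra_inP : V algebra_of }.

Definition semidegenerate tau (V : variety tau) :=
  forall A : algebra_in V, nontrivial A -> forall a : A, ~ subuniverse [set a].

Record is_congruence tau (A : algebra tau) (R : A -> A -> Prop) : Prop :=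
  IsCongruence {
    congr_refl : forall x, R x x;
    congr_sym : forall x y, R x y -> R y x;
    congr_trans : forall y x z, R x y -> R y z -> R x z;
    congr_op : forall f (s t : 'I_(arity f) -> A),
      (forall i, R (s i) (t i)) -> R (interp A f s) (interp A f t) }.

Record Con tau (A : algebra tau) := Cong {
  cong_rel :> A -> A -> Prop;
  congP : is_congruence cong_rel }.

HB.instance Definition _ tau (A : algebra tau) := gen_eqMixin (Con A).
HB.instance Definition _ tau (A : algebra tau) := gen_choiceMixin (Con A).

Section ConLattice.
Variables (tau : signature) (A : algebra tau).
Implicit Types (alpha beta gamma : Con A) (S : set (Con A)).

Lemma cong_ext alpha beta : (forall x y, alpha x y <-> beta x y) -> alpha = beta.
Proof.
case: alpha beta => [R hR] [R' hR'] /= RR'.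
have {RR'}E : R = R' by apply/funext => x; apply/funext => y; apply/propext.
by rewrite -{R'}E in hR' *; rewrite (Prop_irrelevance hR hR').
Qed.

Lemma cong_inf_subproof S :
  is_congruence (fun x y : A => forall theta, S theta -> theta x y).
Proof.
split=> [x t St|x y h t St|y x z h1 h2 t St|f u v h t St].
- exact: congr_refl (congP t) x.
- exact: (congr_sym (congP t)) (h _ St).
- exact: (congr_trans (congP t)) (h1 _ St) (h2 _ St).
- by apply: (congr_op (congP t)) => i; exact: h.
Qed.
Definition cong_inf S : Con A := Cong (cong_inf_subproof S).

Definition cg (X : set (A * A)) : Con A :=
  cong_inf [set theta : Con A | forall x y, X (x, y) -> theta x y].

Definition cong_sup S : Con A :=
  cg [set p | exists2 theta, S theta & theta p.1 p.2].

Lemma cong_meet_subproof alpha beta :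
  is_congruence (fun x y => alpha x y /\ beta x y).
Proof.
have [a1 a2 a3 a4] := congP alpha; have [b1 b2 b3 b4] := congP beta.
split=> [x|x y []|y x z [? ?] []|f u v h]; split; eauto.
- by apply: a4 => i; case: (h i).
- by apply: b4 => i; case: (h i).
Qed.
Definition cong_meet alpha beta : Con A := Cong (cong_meet_subproof alpha beta).

Definition cong_join alpha beta : Con A :=
  cg [set p | alpha p.1 p.2 \/ beta p.1 p.2].

Lemma cong_bot_subproof : is_congruence (fun x y : A => x = y).
Proof.
split=> [//|//|y x z -> //|f u v h].
by congr interp; apply/funext.
Qed.
Definition cong_bot : Con A := Cong cong_bot_subproof.

Lemma cong_top_subproof : is_congruence (fun x y : A => True).
Proof. by []. Qed.
Definition cong_top : Con A := Cong cong_top_subproof.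

Definition cong_le : rel (Con A) :=
  fun alpha beta => `[< forall x y, alpha x y -> beta x y >].

Lemma cong_le_refl : reflexive cong_le.
Proof. by move=> t; apply/asboolP. Qed.

Lemma cong_le_anti : antisymmetric cong_le.
Proof. by move=> s t /andP[/asboolP st /asboolP ts]; apply: cong_ext; split; auto. Qed.

Lemma cong_le_trans : transitive cong_le.
Proof. by move=> t s u /asboolP st /asboolP tu; apply/asboolP; auto. Qed.

HB.instance Definition _ := Order.Le_isPOrder.Build (Order.Disp tt tt) (Con A)
  cong_le_refl cong_le_anti cong_le_trans.

Lemma cong_leP alpha beta :
  reflect (forall x y, alpha x y -> beta x y) (alpha <= beta)%O.
Proof. exact: asboolP. Qed.

Lemma cong_meetP gamma alpha beta : (gamma <= cong_meet alpha beta)%O =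
  (gamma <= alpha)%O && (gamma <= beta)%O.
Proof.
apply/cong_leP/andP => [h|[/cong_leP h1 /cong_leP h2]]; last by split; auto.
by split; apply/cong_leP => x y /h [].
Qed.

Lemma cgP (X : set (A * A)) gamma :
  reflect (forall x y, X (x, y) -> gamma x y) (cg X <= gamma)%O.
Proof.
apply: (iffP (cong_leP _ _)) => h x y; last by apply.
by move=> Xxy; apply: h => t; apply.
Qed.

Lemma cong_joinP alpha beta gamma : (cong_join alpha beta <= gamma)%O =
  (alpha <= gamma)%O && (beta <= gamma)%O.
Proof.
apply/cgP/andP => [h|[/cong_leP h1 /cong_leP h2] x y [|]]; auto.
by split; apply/cong_leP => x y xy; apply: h; [left|right].
Qed.

HB.instance Definition _ := Order.POrder_MeetJoin_isLattice.Build
  (Order.Disp tt tt) (Con A) cong_meetP cong_joinP.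

Lemma cong_le0x alpha : (cong_bot <= alpha)%O.
Proof. by apply/cong_leP => x y /= ->; exact: congr_refl (congP alpha) _. Qed.
HB.instance Definition _ :=
  Order.hasBottom.Build (Order.Disp tt tt) (Con A) cong_le0x.

Lemma cong_lex1 alpha : (alpha <= cong_top)%O.
Proof. by apply/cong_leP. Qed.
HB.instance Definition _ :=
  Order.hasTop.Build (Order.Disp tt tt) (Con A) cong_lex1.

Lemma cong_supP S gamma :
  (cong_sup S <= gamma)%O <-> (forall theta, S theta -> (theta <= gamma)%O).
Proof.
split=> [/cgP h t St|h]; first by apply/cong_leP => x y xy; apply: h; exists t.
by apply/cgP => x y [t St /=]; exact/cong_leP/h.
Qed.

Lemma cong_infP S gamma :
  (gamma <= cong_inf S)%O <-> (forall theta, S theta -> (gamma <= theta)%O).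
Proof.
split=> [/cong_leP h t St|h]; first by apply/cong_leP => x y /h; apply.
by apply/cong_leP => x y xy t St; have /cong_leP := h t St; apply.
Qed.

Definition compact_cong : set (Con A) := [set alpha |
  forall S, (alpha <= cong_sup S)%O ->
    exists T, [/\ finite_set T, T `<=` S & (alpha <= cong_sup T)%O]].

Lemma mem_cong_sup S theta x y : S theta -> theta x y -> cong_sup S x y.
Proof. by move=> St txy gamma; apply; exists theta. Qed.

Lemma cong_sup_sub S T : S `<=` T -> (cong_sup S <= cong_sup T)%O.
Proof. by move=> ST; apply/cong_supP => t /ST Tt; apply/cong_leP => x y; exact: mem_cong_sup. Qed.

Lemma cong_sup_finitary S x y : cong_sup S x y ->
  exists T, [/\ finite_set T, T `<=` S & cong_sup T x y].
Proof.
pose R x y := exists T, [/\ finite_set T, T `<=` S & cong_sup T x y].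
have RP : is_congruence R.
  split=> [z|z t [T [fT TS zt]]|z u t [T [fT TS ut]] [T' [fT' TS' zt]]|f u v /choice[T TP]].
  - by exists set0; split=> //; exact: congr_refl (congP _) _.
  - by exists T; split=> //; exact: (congr_sym (congP _)).
  - exists (T `|` T'); split; [by rewrite finite_setU|by move=> s [/TS|/TS']|].
    apply: (congr_trans (congP _)) (_ : cong_sup (T `|` T') u z) _.
      by move: ut; apply/cong_leP/cong_sup_sub => s; left.
    by move: zt; apply/cong_leP/cong_sup_sub => s; right.
  - exists (\bigcup_(i in setT) T i); split.
    + by apply: bigcup_finite => // i _; case: (TP i).
    + by move=> s [i _]; case: (TP i) => _ + _; apply.
    + apply: (congr_op (congP _)) => i; case: (TP i) => _ _.
      by apply/cong_leP/cong_sup_sub; exact: bigcup_sup.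
suff /cong_leP : (cong_sup S <= Cong RP)%O by apply.
apply/cong_supP => t St; apply/cong_leP => u v uv /=.
by exists [set t]; split=> [//|_ -> //|]; exact: (mem_cong_sup (theta := t)).
Qed.

Lemma compact_congP alpha :
  compact_cong alpha <-> exists2 X : set (A * A), finite_set X & alpha = cg X.
Proof.
split=> [ka|[X fX ->] S /cgP XS].
  pose P := [set p : A * A | alpha p.1 p.2].
  have [|T [fT TP aT]] := ka ((fun p => cg [set p]) @` P).
    apply/cong_leP => x y xy; apply: (mem_cong_sup (theta := cg [set (x, y)])).
      by exists (x, y).
    by move=> t; apply.
  have Pgen (t : Con A) : exists p, T t -> P p /\ cg [set p] = t.
    have [/TP[p Pp <-]|nTt] := pselect (T t); first by exists p.
    case: (carrier_inh A) => x; by exists (x, x) => /nTt.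
  have [g gP] := choice Pgen.
  exists (g @` T); first exact: finite_image.
  apply/eqP; rewrite eq_le; apply/andP; split.
    apply: le_trans aT _; apply/cong_supP => t Tt.
    have [_ {1}<-] := gP _ Tt; apply/cgP => x y xy.
    by move=> u; apply; exists t.
  apply/cgP => x y [t Tt gt]; have [] := gP _ Tt.
  by rewrite gt.
have /choice[T TP] (p : A * A) : exists T : set (Con A), X p ->
    [/\ finite_set T, T `<=` S & cong_sup T p.1 p.2].
  case: p => x y.
  have [/XS/cong_sup_finitary[T ?]|nX] := pselect (X (x, y)); first by exists T.
  by exists set0 => /nX.
exists (\bigcup_(p in X) T p); split.
- by apply: bigcup_finite => // p /TP[].
- by move=> t [p /TP[_ + _]]; apply.
- apply/cgP => x y Xxy; have [_ _] := TP _ Xxy.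
  by apply/cong_leP/cong_sup_sub; exact: bigcup_sup.
Qed.

Lemma compact_cong_bot : compact_cong \bot%O.
Proof. by move=> S _; exists set0; split=> //; exact: le0x. Qed.

End ConLattice.

Definition congruence_modular tau (V : variety tau) :=
  forall (A : algebra_in V) (alpha beta gamma : Con A), (alpha <= gamma)%O ->
    (alpha `|` (beta `&` gamma) = (alpha `|` beta) `&` gamma)%O.

Section QuotientAlgebra.
Variables (tau : signature) (A : algebra tau) (theta : Con A).

Definition cong_rel_bool : rel A := fun x y => `[< theta x y >].

Lemma cong_rel_bool_equiv : equiv_class_of cong_rel_bool.
Proof.
split=> [x|x y|y x z /asboolP xy /asboolP yz].
- exact/asboolP/(congr_refl (congP theta)).
- by apply/asboolP/asboolP; exact: (congr_sym (congP theta)).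
- by apply/asboolP; exact: (congr_trans (congP theta)) xy yz.
Qed.

Definition cong_equiv := EquivRelPack cong_rel_bool_equiv.

Definition quotient_carrier := {eq_quot cong_equiv}.

Lemma quotient_inh : inhabited quotient_carrier.
Proof. by case: (carrier_inh A) => x; exact: (inhabits (\pi_quotient_carrier x)). Qed.

Definition quotient_algebra : algebra tau :=
  @Algebra tau quotient_carrier quotient_inh
    (fun f args => \pi_quotient_carrier (interp A f (fun i => repr (args i)))).

Definition quotient_pi (x : A) : quotient_algebra := \pi_quotient_carrier x.

Lemma quotient_piP x y : quotient_pi x = quotient_pi y <-> theta x y.
Proof. by split=> [/eqmodP/asboolP|xy]; last exact/eqmodP/asboolP. Qed.

Lemma quotient_homP f (args : 'I_(arity f) -> A) :
  quotient_pi (interp A f args) =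
  interp quotient_algebra f (fun i => quotient_pi (args i)).
Proof.
apply/quotient_piP/(congr_op (congP theta)) => i; apply/quotient_piP.
by rewrite /quotient_pi reprK.
Qed.

Definition quotient_hom : hom A quotient_algebra := 
  @Hom tau A quotient_algebra quotient_pi quotient_homP.

Lemma quotient_hom_surj : surjective quotient_hom.
Proof. by move=> q; exists (repr q); exact: reprK. Qed.

End QuotientAlgebra.

(* The set of pairs (f(a, ..., a), a) is finite; the quotient of A by the
   congruence it generates has a one-element subalgebra. *)
Lemma compact_cong_top tau (V : variety tau) (sd : semidegenerate V)
  (A : algebra_in V) : compact_cong (\top%O : Con A).
Proof.
apply/compact_congP; case: (carrier_inh A) => a.
pose X := [set (interp A f (fun=> a), a) | f in [set: tau]].
exists X; first exact/finite_image/finite_finset.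
apply/esym/eqP; rewrite eq_le lex1 /=; apply/cong_leP => x y _.
pose Q := quotient_algebra (cg X); pose q := quotient_hom (cg X).
have VQ : V Q by exact: (variety_hom (quotient_hom_surj (theta := cg X)) (algebra_inP A)).
have [//|nxy] := pselect (cg X x y); exfalso.
apply: (sd (AlgebraIn VQ)) (q a) _.
  by exists (q x), (q y) => /quotient_piP.
move=> f args argsE; have -> : args = fun=> q a by apply/funext.
rewrite -homP; apply/quotient_piP => t; apply; by exists f.
Qed.

Section HomCongruences.
Variables (tau : signature) (A B : algebra tau) (h : hom A B).

Lemma preim_cong_subproof (theta : Con B) :
  is_congruence (fun x y => theta (h x) (h y)).
Proof.
have [r sy tr op] := congP theta.
split=> [x|x y|y x z|f s t st]; [exact: r|exact: sy|exact: tr|].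
by rewrite !homP; exact: op.
Qed.
Definition preim_cong (theta : Con B) : Con A := Cong (preim_cong_subproof theta).

Definition ker_cong : Con A := preim_cong \bot%O.

(* For h surjective and theta above the kernel, the set of pairs (h x, h y) with
   theta x y is already a congruence: see im_congE. *)
Definition im_cong (theta : Con A) : Con B :=
  cg [set p | exists x y, theta x y /\ p = (h x, h y)].

Lemma im_congE (theta : Con A) : surjective h -> (ker_cong <= theta)%O ->
  forall x y, im_cong theta (h x) (h y) <-> theta x y.
Proof.
move=> hs /cong_leP kt; have [t1 t2 t3 t4] := congP theta.
pose R u v := forall x y, h x = u -> h y = v -> theta x y.
have RP : is_congruence R.
  split=> [u x y <- /esym|u v uv x y xv yu|v u w uv vw x z xu zw|f s t st x y xs yt].
  - exact: kt.
  - exact/t2/uv.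
  - by have [y yv] := hs v; apply: t3 (uv _ _ xu yv) (vw _ _ yv zw).
  - have [s' s'E] := choice (fun i => hs (s i)).
    have [t' t'E] := choice (fun i => hs (t i)).
    apply: (t3 (interp A f s')); first apply: kt.
      by rewrite /= xs homP; congr interp; apply/funext => i; rewrite s'E.
    apply: (t3 (interp A f t')); last apply: kt.
      by apply: t4 => i; apply: st.
    by rewrite /= yt homP; congr interp; apply/funext => i; rewrite t'E.
move=> x y; split=> [xy|xy t]; last by apply; exists x, y.
suff /cong_leP /(_ _ _ xy) : (im_cong theta <= Cong RP)%O by apply.
apply/cgP => _ _ [u [v [uv [-> ->]]]] u' v' u'u v'v /=.
exact: t3 (t3 _ _ _ (kt _ _ u'u) uv) (kt _ _ (esym v'v)).
Qed.

End HomCongruences.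

Section Commutator.
Variables (tau : signature) (V : variety tau).

Definition commutator_operation
    (C : forall A : algebra_in V, Con A -> Con A -> Con A) :=
  forall (A B : algebra_in V) (h : hom A B), surjective h ->
  forall alpha beta : Con A,
    (C A alpha beta <= alpha `&` beta)%O /\
    (C A alpha beta `|` ker_cong h)%O =
      preim_cong h (C B (im_cong h (alpha `|` ker_cong h)%O)
                        (im_cong h (beta `|` ker_cong h)%O)).

(* The pointwise supremum of all commutator operations is itself one, hence the
   greatest of them: see commutatorP and commutator_greatest. *)
Definition commutator (A : algebra_in V) (alpha beta : Con A) : Con A :=
  cong_sup [set gamma | exists2 C, commutator_operation C & gamma = C A alpha beta].

Lemma commutator_greatest C : commutator_operation C ->
  forall (A : algebra_in V) (alpha beta : Con A),
    (C A alpha beta <= commutator alpha beta)%O.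
Proof. by move=> hC A a b; apply/cong_leP => x y; apply: mem_cong_sup; exists C. Qed.

Lemma commutatorP : commutator_operation commutator.
Proof.
move=> A B h hs a b; split.
  apply/cong_supP => _ [C hC ->].
  exact: (proj1 (hC A B h hs a b)).
set k := ker_cong h; set a' := im_cong h _; set b' := im_cong h _.
have CE C : commutator_operation C ->
    (C A a b `|` k)%O = preim_cong h (C B a' b').
  by move=> hC; case: (hC A B h hs a b).
apply/eqP; rewrite eq_le; apply/andP; split.
  rewrite leUx; apply/andP; split.
    apply/cong_supP => _ [C hC ->].
    apply: le_trans (leUl _ k) _; rewrite CE //; apply/cong_leP => x y /=.
    by have /cong_leP := commutator_greatest hC a' b'; apply.
  apply/cong_leP => x y /= ->; exact: (congr_refl (congP (commutator a' b'))).
apply/cong_leP => x y /= xy.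
have kL : (k <= commutator a b `|` k)%O by exact: leUr.
apply/(im_congE hs kL); move: x y xy => x y.
suff /cong_leP : (commutator a' b' <= im_cong h (commutator a b `|` k)%O)%O by apply.
apply/cong_supP => _ [C hC ->]; apply/cong_leP => u v.
have [{}x <-] := hs u; have [{}y <-] := hs v => xy.
apply/(im_congE hs kL).
have : preim_cong h (C B a' b') x y by [].
rewrite -CE //; apply/cong_leP; rewrite leUx leUr andbT.
by apply: le_trans (leUl _ _); exact: commutator_greatest.
Qed.

Variable A : algebra_in V.
Implicit Types alpha beta theta phi : Con A.

Definition annihilator alpha : Con A :=
  cong_sup [set gamma : Con A | commutator alpha gamma = \bot%O].

Definition prime_cong phi := phi <> \top%O /\
  forall alpha beta, (commutator alpha beta <= phi)%O ->
    (alpha <= phi)%O \/ (beta <= phi)%O.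

Definition radical theta : Con A :=
  cong_inf [set phi | prime_cong phi /\ (theta <= phi)%O].

Definition semiprime := radical \bot%O = \bot%O.

Inductive in_compact_closure : Con A -> Prop :=
| Closure_compact alpha : compact_cong alpha -> in_compact_closure alpha
| Closure_join alpha beta : in_compact_closure alpha ->
    in_compact_closure beta -> in_compact_closure (alpha `|` beta)%O
| Closure_comm alpha beta : in_compact_closure alpha ->
    in_compact_closure beta -> in_compact_closure (commutator alpha beta).

Definition compact_closure : set (Con A) := [set alpha | in_compact_closure alpha].

Lemma comm_le_meet alpha beta : (commutator alpha beta <= alpha `&` beta)%O.
Proof. by apply/cong_supP => _ [C hC ->]; case: (hC A A (Hom (fun _ _ => erefl)) (fun y => ex_intro _ y erefl) alpha beta). Qed.

Lemma prime_comm phi alpha beta : prime_cong phi ->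
  (commutator alpha beta <= phi)%O = (alpha <= phi)%O || (beta <= phi)%O.
Proof.
move=> [_ hphi]; apply/idP/orP => [/hphi //|ab].
apply: le_trans (comm_le_meet alpha beta) _.
by case: ab => h; [rewrite (le_trans (leIl _ _))|rewrite (le_trans (leIr _ _))].
Qed.

Lemma radicalP alpha beta : radical alpha = radical beta <->
  (forall phi, prime_cong phi -> (alpha <= phi)%O = (beta <= phi)%O).
Proof.
have le_rad theta : (theta <= radical theta)%O by apply/cong_infP => phi [].
have rad_le theta phi : prime_cong phi -> (theta <= phi)%O = (radical theta <= phi)%O.
  move=> phiP; apply/idP/idP => [tphi|]; last exact: le_trans.
  have /cong_infP := lexx (radical theta); exact.
split=> [ab phi phiP|ab]; first by rewrite (rad_le alpha) // (rad_le beta) // ab.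
congr cong_inf; apply/funext => phi; apply/propext.
by split=> -[phiP h]; split=> //; move: h; rewrite ab.
Qed.

Definition radical_eq : rel compact_closure :=
  fun a b => radical (val a) == radical (val b).

Lemma radical_eq_equiv : equiv_class_of radical_eq.
Proof.
split=> [x|x y|y x z]; rewrite /radical_eq.
- exact: eqxx.
- exact/eqP/eqP.
- by move=> /eqP ->.
Qed.

Definition radical_equiv := EquivRelPack radical_eq_equiv.

End Commutator.
Arguments compact_closure {tau V} A.

(* The lattice L(A). Semidegeneracy of V is a parameter only because the top
   element is the class of the full congruence, which must be compact. *)
Definition reticulation tau (V : variety tau) (sd : semidegenerate V)
  (A : algebra_in V) := {eq_quot (radical_equiv A)}.

HB.instance Definition _ tau (V : variety tau) (sd : semidegenerate V)
  (A : algebra_in V) := Choice.on (reticulation sd A).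
HB.instance Definition _ tau (V : variety tau) (sd : semidegenerate V)
  (A : algebra_in V) := EqQuotient.on (reticulation sd A).

Section Reticulation.
Variables (tau : signature) (V : variety tau) (sd : semidegenerate V).
Variable A : algebra_in V.
Local Notation CA := (compact_closure A).
Local Notation L := (reticulation sd A).
Implicit Types (a b : CA) (x y z : L).

Definition reticulation_map a : L := \pi_L a.
Local Notation lambda := reticulation_map.

Lemma reticulation_mapP a b :
  lambda a = lambda b <-> radical (val a) = radical (val b).
Proof. by split=> [/eqmodP/eqP|ab]; last exact/eqmodP/eqP. Qed.

Definition closure_elt alpha (h : CA alpha) : CA := exist _ alpha (mem_set h).

Definition closure_join a b : CA :=
  closure_elt (Closure_join (set_valP a) (set_valP b)).
Definition closure_comm a b : CA :=
  closure_elt (Closure_comm (set_valP a) (set_valP b)).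
Definition closure_bot : CA := closure_elt (Closure_compact (@compact_cong_bot tau A)).
Definition closure_top : CA := closure_elt (Closure_compact (compact_cong_top sd (A := A))).

Definition ret_meet x y : L := lambda (closure_comm (repr x) (repr y)).
Definition ret_join x y : L := lambda (closure_join (repr x) (repr y)).

Let below phi x := (val (repr x) <= phi)%O.

Let below_lambda phi a : prime_cong phi -> below phi (lambda a) = (val a <= phi)%O.
Proof.
by move: phi; apply/radicalP/reticulation_mapP; rewrite /reticulation_map reprK.
Qed.

Let below_meet phi x y : prime_cong phi ->
  below phi (ret_meet x y) = below phi x || below phi y.
Proof. by move=> phiP; rewrite below_lambda //= prime_comm. Qed.

Let below_join phi x y : prime_cong phi ->
  below phi (ret_join x y) = below phi x && below phi y.
Proof. by move=> phiP; rewrite below_lambda //= leUx. Qed.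

Let below_inj x y : (forall phi, prime_cong phi -> below phi x = below phi y) -> x = y.
Proof.
by move=> xy; rewrite -[x]reprK -[y]reprK; apply/reticulation_mapP/radicalP.
Qed.

Let belowE := (below_meet, below_join).

Lemma ret_meetC : commutative ret_meet.
Proof. by move=> x y; apply: below_inj => p pP; rewrite !belowE // orbC. Qed.
Lemma ret_joinC : commutative ret_join.
Proof. by move=> x y; apply: below_inj => p pP; rewrite !belowE // andbC. Qed.
Lemma ret_meetA : associative ret_meet.
Proof. by move=> x y z; apply: below_inj => p pP; rewrite !belowE // orbA. Qed.
Lemma ret_joinA : associative ret_join.
Proof. by move=> x y z; apply: below_inj => p pP; rewrite !belowE // andbA. Qed.
Lemma ret_joinKI y x : ret_meet x (ret_join x y) = x.
Proof. by apply: below_inj => p pP; rewrite !belowE //; case: (below p x); case: (below p y). Qed.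
Lemma ret_meetKU y x : ret_join x (ret_meet x y) = x.
Proof. by apply: below_inj => p pP; rewrite !belowE //; case: (below p x); case: (below p y). Qed.
Lemma ret_meetUl : left_distributive ret_meet ret_join.
Proof. by move=> x y z; apply: below_inj => p pP; rewrite !belowE //; case: (below p z); rewrite ?orbT ?orbF. Qed.
Lemma ret_meetxx : idempotent_op ret_meet.
Proof. by move=> x; apply: below_inj => p pP; rewrite !belowE // orbb. Qed.

HB.instance Definition _ := Order.isMeetJoinDistrLattice.Build
  (Order.Disp tt tt) L (fun _ _ => erefl) (fun _ _ => erefl)
  ret_meetC ret_joinC ret_meetA ret_joinA ret_joinKI ret_meetKU
  ret_meetUl ret_meetxx.

Lemma reticulation_map_meet a b :
  (lambda a `&` lambda b)%O = lambda (closure_comm a b).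
Proof. by apply: below_inj => p pP; rewrite belowE // !below_lambda //= prime_comm. Qed.

Lemma reticulation_map_join a b :
  (lambda a `|` lambda b)%O = lambda (closure_join a b).
Proof. by apply: below_inj => p pP; rewrite belowE // !below_lambda //= leUx. Qed.

Lemma ret_le0x x : (lambda closure_bot <= x)%O.
Proof.
rewrite leEmeet; apply/eqP/below_inj => p pP.
by rewrite belowE // below_lambda //= le0x.
Qed.
HB.instance Definition _ := Order.hasBottom.Build (Order.Disp tt tt) L ret_le0x.

Lemma ret_lex1 x : (x <= lambda closure_top)%O.
Proof.
rewrite leEmeet; apply/eqP/below_inj => p pP.
rewrite belowE // below_lambda //= le1x.
by case: pP => /eqP/negbTE ->; rewrite orbF.
Qed.
HB.instance Definition _ := Order.hasTop.Build (Order.Disp tt tt) L ret_lex1.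

Definition ideal_cong (I : set L) : Con A :=
  cong_sup [set val a | a in [set a : CA | compact_cong (val a) /\ I (lambda a)]].

End Reticulation.

Record lattice_ideal d (L : tbDistrLatticeType d) (I : set L) : Prop :=
  LatticeIdeal {
    ideal_bot : I \bot%O;
    ideal_le : forall x y, (x <= y)%O -> I y -> I x;
    ideal_join : forall x y, I x -> I y -> I (x `|` y)%O }.

Definition Ann d (L : tbDistrLatticeType d) (I : set L) : set L :=
  [set x | forall y, I y -> (x `&` y)%O = \bot%O].

(* Main.v *)
(** In a semiprime algebra a congruence is trivial as soon as it lies below every
    prime, so [[alpha, beta] = bot] holds iff every prime contains [alpha] or
    [beta]; likewise [lambda a /\ lambda b = 0] holds in the reticulation iff
    every prime contains [a] or [b]. Both sides of the theorem are therefore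
    described by the same condition on primes, since every congruence is a join
    of compact ones and an element of [C(A)] whose class is in the ideal [I] lies
    below [I_*]. *)
Require Import Defs.
From mathcomp Require Import all_boot all_order.
From mathcomp Require Import boolp classical_sets.

Import Order.TTheory.
Local Open Scope classical_set_scope.
Local Open Scope order_scope.

(** Each pair in [alpha] generates a principal congruence, which is compact and lies below
    [alpha]. *)
Lemma le_compact_cong (tau : signature) (A : algebra tau) (alpha beta : Con A) :
  (forall gamma : Con A, compact_cong gamma -> gamma <= alpha -> gamma <= beta) ->
  alpha <= beta.
Proof.
move=> h; apply/cong_leP => x y axy.
have/cgP : cg [set (x, y)] <= beta; last by apply.
apply: h; first by apply/compact_congP; exists [set (x, y)].
by apply/cgP => u v [-> ->].
Qed.

Section SemiprimeReticulation.
Context {tau : signature} {V : variety tau} (sd : semidegenerate V).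
Context {A : algebra_in V}.
Local Notation lambda := (reticulation_map sd).

Lemma commutator_eq_bot (sp : semiprime A) (alpha beta : Con A) :
  commutator alpha beta = \bot <->
  (forall phi, prime_cong phi -> alpha <= phi \/ beta <= phi).
Proof.
split=> [ab phi phiP|h]; first by apply/orP; rewrite -prime_comm // ab le0x.
(* Semiprimeness turns [\bot] into the intersection of all primes. *)
apply/eqP; rewrite -lex0 -[X in _ <= X]sp; apply/cong_infP => phi [phiP _].
by rewrite prime_comm //; apply/orP/h.
Qed.

Lemma reticulation_map_meet_eq_bot (a b : compact_closure A) :
  lambda a `&` lambda b = \bot <->
  (forall phi, prime_cong phi -> val a <= phi \/ val b <= phi).
Proof.
rewrite reticulation_map_meet.
split=> [/reticulation_mapP/radicalP h phi phiP|h].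
  by apply/orP; rewrite -prime_comm // h // le0x.
apply/reticulation_mapP/radicalP => phi phiP.
by rewrite /= prime_comm // le0x; apply/orP/h.
Qed.

Lemma reticulation_map_le (a b : compact_closure A) :
  val a <= val b -> lambda a <= lambda b.
Proof.
move=> ab; rewrite leEmeet reticulation_map_meet.
apply/eqP/reticulation_mapP/radicalP => phi phiP; rewrite /= prime_comm //.
by apply/orP/idP => [[//|]|]; [exact: le_trans|left].
Qed.

Lemma le_ideal_cong (I : set (reticulation sd A)) (a : compact_closure A) :
  compact_cong (val a) -> I (lambda a) -> val a <= ideal_cong I.
Proof.
move=> ka Ia; apply/cong_leP => x y.
by apply: mem_cong_sup; exists a.
Qed.

(* [val a] itself need not be compact, being possibly a commutator. *)
Lemma closure_le_ideal_cong (I : set (reticulation sd A)) (a : compact_closure A) :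
  lattice_ideal I -> I (lambda a) -> val a <= ideal_cong I.
Proof.
move=> hI Ia; apply: le_compact_cong => gamma kgamma gamma_a.
apply: (le_ideal_cong I (closure_elt (Closure_compact kgamma)) kgamma).
apply: ideal_le hI _ _ _ Ia; exact: reticulation_map_le.
Qed.

End SemiprimeReticulation.

Theorem proposition4p8 (tau : signature) (V : variety tau)
    (sd : semidegenerate V) (cm : congruence_modular V)
    (A : algebra_in V) (sp : semiprime A)
    (I : set (reticulation sd A)) (hI : lattice_ideal I) :
  ideal_cong (Ann I) = annihilator (ideal_cong I).
Proof.
apply/eqP; rewrite eq_le; apply/andP; split.
  apply/cong_supP => _ [a [ka Aa] <-].
  (* It suffices that [val a] itself annihilates [ideal_cong I], as it is then one of the
     congruences joined in the annihilator. *)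
  apply/cong_leP => x y; apply: mem_cong_sup.
  apply/commutator_eq_bot => // phi phiP.
  have [|a_phi] := boolP (val a <= phi); first by right.
  (* A prime not above [val a] must contain every generator of [ideal_cong I]. *)
  left; apply/cong_supP => _ [b [kb Ib] <-].
  have /reticulation_map_meet_eq_bot/(_ phi phiP) [h|//] := Aa _ Ib.
  by rewrite h in a_phi.
apply/cong_supP => gamma /commutator_eq_bot gammaP.
apply: le_compact_cong => alpha kalpha alpha_gamma.
apply: (le_ideal_cong sd _ (closure_elt (Closure_compact kalpha)) kalpha).
(* [repr y] may fail to be compact, so it need not be a generator of [ideal_cong I];
   [closure_le_ideal_cong] still bounds it. *)
move=> y; rewrite -[y]reprK => Iy.
apply/reticulation_map_meet_eq_bot => phi phiP.
have [I_phi|gamma_phi] := gammaP sp _ phiP; last first.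
  by left; exact: le_trans alpha_gamma gamma_phi.
by right; exact: le_trans (closure_le_ideal_cong sd I _ hI Iy) I_phi.
Qed.
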